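(* Let $D\ge 1$ be an integer, let $U=\mathcal{T}_D=\{u_1,\dots,u_l\}$ with $l=\binom{D+n-1}{n-1}$, and let $L$ be a relative involutive division on $U$. Suppose that the terms of $U$ can be enumerated $u_1,\dots,u_l$ in such a way that $$M_L(u_1,U)\subseteq M_L(u_2,U)\subseteq\cdots\subseteq M_L(u_l,U)=\{x_1,\dots,x_n\}.$$ For $1\le i\le n$ put $\overline{u}_i=x_i^D$. Then there is a reordering and relabelling (permutation) of the variables after which all of the following properties hold: 1. $M_L(\overline{u}_1,U)\subseteq M_L(\overline{u}_2,U)\subseteq\cdots\subseteq M_L(\overline{u}_n,U)\subseteq\{x_1,\dots,x_n\}$; 2. the unique term $u_l\in U$ with $M_L(u_l,U)=\{x_1,\dots,x_n\}$ has the form $u_l=x_i^D$ for some $1\le i\le n$; 3. for every $1\le i\le n$, $M_L(\overline{u}_i,U)=\{x_j : 1\le j\le i\}$; 4. under this relabelling, with the variables ordered $x_1<\cdots<x_n$, $L$ coincides with Pommaret division on $U$, i.e. for every $u\in U$, $M_L(u,U)=\{x_i : x_i\le \min(u)\}$.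
   Context: $\mathcal{T}$ is the set (monoid) of all terms (monic monomials) $x_1^{\gamma_1}\cdots x_n^{\gamma_n}$ in the variables $x_1,\dots,x_n$, and $\mathcal{T}_D$ is the set of terms of degree $D$. Given an ordering $x_1<\dots<x_n$ of the variables and a term $u\ne 1$, $\min(u)$ is the smallest variable dividing $u$. A relative involutive division $L$ on a finite set $U\subset\mathcal{T}$ is the assignment, to each $u\in U$, of a partition $\{x_1,\dots,x_n\}=M_L(u,U)\sqcup NM_L(u,U)$ of the variables into multiplicative and non-multiplicative ones such that, setting $L(u,U)=\{x_1^{a_1}\cdots x_n^{a_n} : a_i\ne 0\Rightarrow x_i\in M_L(u,U)\}$ and $C_L(u,U)=uL(u,U)=\{uw: w\in L(u,U)\}$ (the cone of $u$): (1) the semigroup ideal $\{\tau u:\tau\in\mathcal{T},u\in U\}$ generated by $U$ equals $\bigcup_{u\in U}C_L(u,U)$; (2) $C_L(u,U)\cap C_L(v,U)=\emptyset$ for all distinct $u,v\in U$. *)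

(* Defs.v *)
From mathcomp Require Import all_boot all_order all_algebra all_fingroup.
From mathcomp Require Import finmap.
From mathcomp Require Import mpoly.

Set Implicit Arguments.
Unset Strict Implicit.
Unset Printing Implicit Defensive.

(* A term x_1^{g_1}...x_n^{g_n} is its exponent vector, a multinomial
   m : 'X_{1..n}.  The monoid of terms is thus written additively: 0%MM is
   the term 1, (u + v)%MM the product uv, (u *+ d)%MM the power u^d, U_(i)%MM
   the variable and (u <= v)%MM divisibility.  Variables are indexed from 0:
   x_{i+1} is i : 'I_n. *)

Definition terms_of_deg (n D : nat) : {fset 'X_{1..n}} :=
  [fset bmnm m | m : 'X_{1..n < D.+1} & mdeg m == D]%fset.

Lemma in_terms_of_deg n D (m : 'X_{1..n}) :
  (m \in terms_of_deg n D) = (mdeg m == D).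
Proof.
apply/imfsetP/idP => [[b /= + ->] //|dm].
have lt_mD : mdeg m < D.+1 by rewrite ltnS (eqP dm).
by exists (BMultinom lt_mD).
Qed.

Definition in_ideal n (U : {fset 'X_{1..n}}) (t : 'X_{1..n}) : Prop :=
  exists tau u, u \in U /\ t = (tau + u)%MM.

Definition supported_on n (S : {set 'I_n}) (w : 'X_{1..n}) : Prop :=
  forall i, w i <> 0 -> i \in S.

Definition in_cone n (M : 'X_{1..n} -> {set 'I_n}) (u t : 'X_{1..n}) : Prop :=
  exists w, supported_on (M u) w /\ t = (u + w)%MM.

(* A division on U is given by its multiplicative sets M u, for u in U; the
   non-multiplicative variables of u are the complement ~: M u.  The values of
   M outside U are irrelevant. *)
Definition relative_involutive_division n (U : {fset 'X_{1..n}})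
    (M : 'X_{1..n} -> {set 'I_n}) : Prop :=
  (forall t, in_ideal U t <-> exists u, u \in U /\ in_cone M u t) /\
  (forall u v, u \in U -> v \in U -> u <> v ->
     ~ exists t, in_cone M u t /\ in_cone M v t).

(* For the ordering given by the indices; None only for the term 1. *)
Definition min_var n (u : 'X_{1..n}) : option 'I_n :=
  [pick i | (U_(i) <= u)%MM &&
            [forall j : 'I_n, (U_(j) <= u)%MM ==> (i <= j)]].

Definition pommaret n (u : 'X_{1..n}) : {set 'I_n} :=
  if min_var u is Some k then [set i : 'I_n | i <= k] else [set: 'I_n].

(* Relabelling by s gives the new name x_i to the old variable x_(s i).
   [relabel_term s] turns the exponent vector of a term in the old names into
   its exponent vector in the new names, and [relabel_div s M] is the division
   M expressed in the new names. *)
Definition relabel_term n (s : {perm 'I_n}) (m : 'X_{1..n}) : 'X_{1..n} :=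
  [multinom m (s i) | i < n].

Definition relabel_div n (s : {perm 'I_n}) (M : 'X_{1..n} -> {set 'I_n})
    (m : 'X_{1..n}) : {set 'I_n} :=
  [set i | s i \in M (relabel_term s^-1 m)].

(* Main.v *)
Require Import Defs.
From mathcomp Require Import all_boot all_order all_algebra all_fingroup.
From mathcomp Require Import finmap.
From mathcomp Require Import mpoly.
From mathcomp Require Import zify.

(** The chain of multiplicative sets enters through comparability: for any two
    terms u and v of degree D, M(u) and M(v) are comparable for inclusion.

    A pure power of x_i is a multiple of no term of degree D other than x_i^D,
    so x_i^(D+1) forces x_i to be multiplicative for x_i^D
    ([own_variable_multiplicative]).  If x_i and x_j were both multiplicative
    for x_i^D and for x_j^D, the two cones would meet at x_i^D x_j^D; so, by
    comparability, the relation x_i \in M(x_j^D) is a total order on the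
    variables.  Relabelling along it makes M(x_i^D) = {x_1, ..., x_i}.  A
    relabelling carries divisions to divisions ([relabel_division]), so one may
    argue in the new names.

    Then M(v) = {x_i : x_i <= min v} follows by descending induction on
    x_j = min v ([multiplicative_eq_below_min]).
    - A variable x_k > x_j in M(v) is impossible: let w come from v by
      replacing each factor x_j with x_k, and a be the exponent of x_j in v.
      The induction hypothesis puts x_j in M(w), so the cones of v and w meet
      at v x_k^a = w x_j^a.
    - x_j is in M(v): the term v x_j is u x_k for some u of degree D and some
      x_k in M(u).  Either k = j and u = v, or x_k > x_j = min u, which the
      first point excludes.
    - Every x_i < x_j is in M(v): M(v) is comparable with
      M(x_i^D) = {x_1, ..., x_i}, which does not contain x_j.

    The largest pure power has all variables multiplicative, and so does u_l;
    two terms with that property have a common multiple in both cones. *)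

Set Implicit Arguments.
Unset Strict Implicit.
Unset Printing Implicit Defensive.

(** * Cones and divisions on the terms of one degree *)

Lemma mem_pure_power n D (i : 'I_n) :
  (U_(i) *+ D)%MM \in terms_of_deg n D.
Proof. by rewrite in_terms_of_deg mdegMn mdeg1 mul1n. Qed.

Lemma in_cone_add_power n (M : 'X_{1..n} -> {set 'I_n}) u i a :
  i \in M u -> in_cone M u (u + U_(i) *+ a)%MM.
Proof.
move=> iM; exists (U_(i) *+ a)%MM; split=> // k.
by rewrite mulmnE mnm1E; case: eqP => [<-|].
Qed.

Lemma in_cone_full n (M : 'X_{1..n} -> {set 'I_n}) u w :
  M u = [set: 'I_n] -> in_cone M u (u + w)%MM.
Proof. by move=> Mu; exists w; split=> // k _; rewrite Mu inE. Qed.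

Lemma cones_meet_eq n (U : {fset 'X_{1..n}}) M u v t :
  relative_involutive_division U M -> u \in U -> v \in U ->
  in_cone M u t -> in_cone M v t -> u = v.
Proof.
move=> [_ dis] uU vU tu tv; apply/eqP/negPn/negP => /eqP uv.
by apply: (dis u v uU vU uv); exists t.
Qed.

(** A cover of v x_j by the cone of a term u of the same degree D as v adds a
    single multiplicative variable to u, so v and u differ by exchanging one
    variable. *)
Lemma cover_next_degree n D M (v : 'X_{1..n}) (j : 'I_n) :
  relative_involutive_division (terms_of_deg n D) M ->
  v \in terms_of_deg n D ->
  exists u k, [/\ u \in terms_of_deg n D, k \in M u
                & (v + U_(j) = u + U_(k))%MM].
Proof.
move=> [cover _] vU.
have /cover [u [uU [w [wM vw]]]] : in_ideal (terms_of_deg n D) (v + U_(j))%MM.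
  by exists U_(j)%MM, v; rewrite addmC.
have /mdeg1P [k /eqP wk] : mdeg w == 1.
  move: vU uU; rewrite !in_terms_of_deg => /eqP dv /eqP du.
  by move/(congr1 mdeg): vw; rewrite !mdegD mdeg1 du dv => /addnI <-.
exists u, k; split=> //; last by rewrite -wk.
by apply: wM; rewrite wk mnm1E eqxx.
Qed.

(** * The order of the variables read off the pure powers *)

Lemma own_variable_multiplicative n D M (i : 'I_n) :
  relative_involutive_division (terms_of_deg n D) M ->
  i \in M (U_(i) *+ D)%MM.
Proof.
move=> hM; have iU := mem_pure_power D i.
have [u [k [uU kM e]]] := cover_next_degree i hM iU.
have ik : k = i.
  apply/eqP; apply/negPn/negP => ki.
  move/mnmP/(_ k): e; rewrite !mnmDE mulmnE !mnm1E eqxx.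
  by rewrite eq_sym (negPf ki) mul0n addn1.
by move: kM e; rewrite ik => iM /addIm ->.
Qed.

Lemma mutually_multiplicative_eq n D M (i j : 'I_n) :
  0 < D -> relative_involutive_division (terms_of_deg n D) M ->
  i \in M (U_(j) *+ D)%MM -> j \in M (U_(i) *+ D)%MM -> i = j.
Proof.
move=> D0 hM ij ji.
have e : (U_(i) *+ D = U_(j) *+ D)%MM.
  apply: (cones_meet_eq hM (mem_pure_power D i) (mem_pure_power D j)
            (in_cone_add_power D ji)).
  by rewrite addmC; apply: in_cone_add_power.
apply/esym/eqP; move/mnmP/(_ i): e; rewrite !mulmnE !mnm1E eqxx.
by case: (j == i) => //; lia.
Qed.

(** Sending an element to the number of elements strictly below it is
    injective, and the inverse of this map lists the elements in order. *)
Lemma total_order_perm n (r : rel 'I_n) :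
  reflexive r -> total r -> antisymmetric r -> transitive r ->
  exists s : {perm 'I_n}, forall i j : 'I_n, r (s i) (s j) = (i <= j).
Proof.
move=> r_refl r_total r_anti r_trans.
pose below i := [set j | (j != i) && r j i].
have rank_lt i : #|below i| < n.
  rewrite -[X in _ < X]card_ord -cardsT; apply: proper_card.
  by apply/properP; split; [apply: subsetT | exists i; rewrite !inE ?eqxx].
pose rank i := Ordinal (rank_lt i).
have rank_mono i j : i != j -> r i j -> rank i < rank j.
  move=> ij rij; apply: proper_card; apply/properP; split.
    apply/subsetP => k; rewrite !inE => /andP[ki rki].
    rewrite (r_trans _ _ _ rki rij) andbT; apply: contra ki => /eqP kj.
    by rewrite kj (r_anti i j) // rij -kj rki.
  by exists i; rewrite !inE ?ij ?rij ?eqxx.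
have rank_inj : injective rank.
  move=> i j e; apply/eqP/negPn/negP => ij.
  case/orP: (r_total i j) => [/(rank_mono _ _ ij)|].
    by rewrite e ltnn.
  by rewrite eq_sym in ij; move/(rank_mono _ _ ij); rewrite e ltnn.
have rankE i j : r i j = (rank i <= rank j).
  have [<-|ij] := eqVneq i j; first by rewrite r_refl leqnn.
  apply/idP/idP => [/(rank_mono _ _ ij)/ltnW //|le_ij].
  case/orP: (r_total i j) => // rji.
  by rewrite eq_sym in ij; have := rank_mono _ _ ij rji; rewrite ltnNge le_ij.
exists (perm rank_inj)^-1%g => i j.
by rewrite rankE -!(permE rank_inj) !permKV.
Qed.

(** Comparability gives totality, and also transitivity: if x_j is in M(x_k^D)
    and k differs from j, then x_k is not in M(x_j^D), so that M(x_j^D) is the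
    smaller of the two sets and its elements are in M(x_k^D). *)
Lemma pure_powers_perm n D M :
  0 < D -> relative_involutive_division (terms_of_deg n D) M ->
  (forall u v, u \in terms_of_deg n D -> v \in terms_of_deg n D ->
     M u \subset M v \/ M v \subset M u) ->
  exists s : {perm 'I_n}, forall i j : 'I_n,
    (s i \in M (U_(s j) *+ D)%MM) = (i <= j).
Proof.
move=> D0 hM cmp.
have cmpX i j := cmp _ _ (mem_pure_power D i) (mem_pure_power D j).
have own i := own_variable_multiplicative i hM.
apply: (@total_order_perm n (fun i j => i \in M (U_(j) *+ D)%MM)).
- by move=> i; apply: own.
- move=> i j; case: (cmpX i j) => /subsetP sub.
    by rewrite (sub _ (own i)).
  by rewrite (sub _ (own j)) orbT.
- by move=> i j /andP[]; apply: mutually_multiplicative_eq.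
- move=> j i k ij jk; case: (cmpX j k) => /subsetP sub; first exact: sub.
  by rewrite -(mutually_multiplicative_eq D0 hM jk (sub _ (own k))).
Qed.

(** * Relabelling the variables *)

Lemma relabel_termE n (s : {perm 'I_n}) m i : relabel_term s m i = m (s i).
Proof. by rewrite mnmE. Qed.

Lemma relabel_termK n (s : {perm 'I_n}) :
  cancel (relabel_term s) (relabel_term s^-1).
Proof. by move=> m; apply/mnmP => i; rewrite !relabel_termE permKV. Qed.

Lemma relabel_termVK n (s : {perm 'I_n}) :
  cancel (relabel_term s^-1) (relabel_term s).
Proof. by move=> m; apply/mnmP => i; rewrite !relabel_termE permK. Qed.

Lemma relabel_termD n (s : {perm 'I_n}) u v :
  relabel_term s (u + v)%MM = (relabel_term s u + relabel_term s v)%MM.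
Proof. by apply/mnmP => i; rewrite !(relabel_termE, mnmDE). Qed.

Lemma relabel_pure_power n (s : {perm 'I_n}) i D :
  relabel_term s^-1 (U_(i) *+ D)%MM = (U_(s i) *+ D)%MM.
Proof.
apply/mnmP => k; rewrite relabel_termE !mulmnE !mnm1E.
by rewrite -(inj_eq (@perm_inj _ s)) permKV.
Qed.

Lemma mem_relabel_term n (s : {perm 'I_n}) D m :
  (relabel_term s m \in terms_of_deg n D) = (m \in terms_of_deg n D).
Proof.
rewrite !in_terms_of_deg !mdegE [in RHS](reindex_perm s).
by congr (_ == D); apply: eq_bigr => i _; rewrite relabel_termE.
Qed.

Lemma in_ideal_relabel n (s : {perm 'I_n}) D t :
  in_ideal (terms_of_deg n D) t ->
  in_ideal (terms_of_deg n D) (relabel_term s t).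
Proof.
move=> [w [u [uU ->]]]; exists (relabel_term s w), (relabel_term s u).
by rewrite mem_relabel_term relabel_termD.
Qed.

Lemma in_cone_relabel n (s : {perm 'I_n}) M u t :
  in_cone (relabel_div s M) u t <->
  in_cone M (relabel_term s^-1 u) (relabel_term s^-1 t).
Proof.
split=> [[w [wM ->]]|[w [wM e]]].
  exists (relabel_term s^-1 w); split; last exact: relabel_termD.
  move=> i; rewrite relabel_termE => /wM.
  by rewrite inE permKV.
exists (relabel_term s w); split.
  by move=> i; rewrite relabel_termE inE => /wM.
by apply: (can_inj (@relabel_termVK _ s)); rewrite relabel_termD relabel_termK.
Qed.

Lemma relabel_division n (s : {perm 'I_n}) D M :
  relative_involutive_division (terms_of_deg n D) M ->
  relative_involutive_division (terms_of_deg n D) (relabel_div s M).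
Proof.
move=> [cover dis]; split=> [t|u v uU vU uv [t [tu tv]]].
  split=> [/(in_ideal_relabel s^-1)/cover [u [uU ut]]|[u [uU ut]]].
    exists (relabel_term s u); rewrite mem_relabel_term; split=> //.
    by apply/in_cone_relabel; rewrite relabel_termK.
  rewrite -[t](relabel_termVK s); apply/in_ideal_relabel/cover.
  exists (relabel_term s^-1 u); rewrite mem_relabel_term; split=> //.
  exact/in_cone_relabel.
apply: (dis (relabel_term s^-1 u) (relabel_term s^-1 v)).
- by rewrite mem_relabel_term.
- by rewrite mem_relabel_term.
- by move/(can_inj (@relabel_termVK _ s)).
- by exists (relabel_term s^-1 t); split; apply/in_cone_relabel.
Qed.

Lemma relabel_div_mono n (s : {perm 'I_n}) (M : 'X_{1..n} -> {set 'I_n}) u v :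
  M (relabel_term s^-1 u) \subset M (relabel_term s^-1 v) ->
  relabel_div s M u \subset relabel_div s M v.
Proof. by move/subsetP=> sub; apply/subsetP => i; rewrite !inE => /sub. Qed.

(** * Smallest variables and Pommaret division *)

Definition is_min_var n (v : 'X_{1..n}) (j : 'I_n) : Prop :=
  0 < v j /\ forall i : 'I_n, 0 < v i -> j <= i.

Lemma exists_min_var n (v : 'X_{1..n}) (k : 'I_n) :
  0 < v k -> exists j, is_min_var v j.
Proof.
move=> vk; case: (@arg_minnP _ k (fun i => 0 < v i) (fun i => i : nat) vk) => j vj jmin.
by exists j.
Qed.

Lemma exists_var n D (v : 'X_{1..n}) :
  0 < D -> v \in terms_of_deg n D -> exists k, 0 < v k.
Proof.
rewrite in_terms_of_deg mdegE => D0 /eqP dv.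
case: (pickP (fun k => 0 < v k)) => [k vk|v0]; first by exists k.
by move: D0; rewrite -dv big1 // => i _; apply/eqP; rewrite eqn0Ngt v0.
Qed.

Lemma pommaret_min_var n (v : 'X_{1..n}) j :
  is_min_var v j -> pommaret v = [set i : 'I_n | i <= j].
Proof.
move=> [vj jmin]; rewrite /pommaret /min_var; case: pickP => [k|/(_ j)].
  rewrite lep1mP -lt0n => /andP[vk /forallP kmin].
  have /implyP := kmin j; rewrite lep1mP -lt0n => /(_ vj) kj.
  suff -> : k = j by [].
  by apply/val_inj/eqP; rewrite eqn_leq kj jmin.
rewrite lep1mP -lt0n vj /= => /negP[]; apply/forallP => i.
by rewrite lep1mP -lt0n; apply/implyP/jmin.
Qed.

(** * Descending induction on the smallest variable *)

(** A multiplicative x_k > x_j = min v would make the cone of v meet that of the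
    term w obtained from v by replacing each factor x_j with x_k: the smallest
    variable of w lies above x_j, so [IH] makes x_j multiplicative for w.  The
    conclusion is about all v with smallest variable x_j because the next lemma
    also needs it at the neighbour u of v that covers v x_j. *)
Lemma multiplicative_le_min n D M (j : 'I_n) :
  relative_involutive_division (terms_of_deg n D) M ->
  (forall (j' : 'I_n) w, j < j' -> w \in terms_of_deg n D ->
     is_min_var w j' -> M w = [set i : 'I_n | i <= j']) ->
  forall v k, v \in terms_of_deg n D -> is_min_var v j ->
  k \in M v -> k <= j.
Proof.
move=> hM IH v k vU [vj jmin] kM; rewrite leqNgt; apply/negP => jk.
have jNk : j != k by rewrite neq_ltn jk.
pose w := (v - U_(j) *+ v j + U_(k) *+ v j)%MM.
have wE : (w + U_(j) *+ v j = v + U_(k) *+ v j)%MM.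
  apply/mnmP => i; rewrite !(mnmDE, mnmBE, mulmnE, mnm1E).
  by case: (eqVneq j i) => [<-|_]; case: (k == _); lia.
have wj : w j = 0.
  by rewrite !(mnmDE, mnmBE, mulmnE, mnm1E) eqxx eq_sym (negPf jNk); lia.
have wk : 0 < w k.
  by rewrite !(mnmDE, mnmBE, mulmnE, mnm1E) eqxx (negPf jNk); lia.
have wU : w \in terms_of_deg n D.
  move: vU; rewrite !in_terms_of_deg => /eqP <-.
  by move/(congr1 mdeg): wE; rewrite !mdegD !mdegMn !mdeg1 => /addIn ->.
have [j' minw] := exists_min_var wk.
have jj' : j < j'.
  case: (minw) => wj' _; rewrite ltn_neqAle; apply/andP; split.
    by apply: contraTneq wj' => /val_inj <-; rewrite wj.
  have : (j' == k) || (0 < v j').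
    move: wj'; rewrite !(mnmDE, mnmBE, mulmnE, mnm1E) (eq_sym k).
    by case: (j' == k) => //=; lia.
  by case/orP => [/eqP ->|/jmin]; first exact: ltnW.
have jMw : j \in M w by rewrite (IH j' w) // inE ltnW.
have e : v = w.
  apply: (cones_meet_eq hM vU wU (in_cone_add_power (v j) kM)).
  by rewrite -wE; apply: in_cone_add_power.
by move: vj; rewrite e wj.
Qed.

Lemma multiplicative_eq_below_min n D M :
  relative_involutive_division (terms_of_deg n D) M ->
  (forall u v, u \in terms_of_deg n D -> v \in terms_of_deg n D ->
     M u \subset M v \/ M v \subset M u) ->
  (forall i : 'I_n, M (U_(i) *+ D)%MM = [set j : 'I_n | j <= i]) ->
  forall v j, v \in terms_of_deg n D -> is_min_var v j ->
  M v = [set i : 'I_n | i <= j].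
Proof.
move=> hM cmp pureM v j.
have [m] := ubnP (n - j); elim: m v j => // m IHm v j ltm vU minv.
have le_min : forall u k, u \in terms_of_deg n D -> is_min_var u j ->
    k \in M u -> k <= j.
  apply: (multiplicative_le_min hM) => j' w jj'; apply: IHm.
  by have := ltn_ord j'; lia.
have jM : j \in M v.
  have [u [k [uU kM e]]] := cover_next_degree j hM vU.
  have [kj|kj] := eqVneq k j.
    by move: kM e; rewrite kj => jM /addIm ->.
  have ue i : u i + (k == i) = v i + (j == i).
    by move/mnmP/(_ i): e; rewrite !mnmDE !mnm1E.
  case: minv => vj jmin.
  (* x_j divides u because v x_j = u x_k with k distinct from j; then x_k
     divides v, so that k is above j. *)
  have minu : is_min_var u j.
    split; first by have := ue j; rewrite (negPf kj) eqxx; lia.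
    move=> i ui; case: (eqVneq j i) => [-> //|ji]; apply: jmin.
    by have := ue i; rewrite (negPf ji); lia.
  have kj' := le_min u k uU minu kM.
  have jk : j <= k.
    apply: jmin; have := ue k; rewrite eqxx eq_sym (negPf kj); lia.
  by case/eqP: kj; apply/val_inj/eqP; rewrite eqn_leq kj' jk.
apply/setP => i; rewrite inE; apply/idP/idP; first exact: le_min.
rewrite leq_eqVlt => /orP[/eqP/val_inj -> //|ij].
case: (cmp _ _ vU (mem_pure_power D i)) => /subsetP sub.
  by have := sub j jM; rewrite pureM inE leqNgt ij.
by apply: sub; rewrite pureM inE.
Qed.

Theorem proposition30 (n D : nat) (hn : 0 < n) (hD : 1 <= D)
  (M : 'X_{1..n} -> {set 'I_n})
  (hM : relative_involutive_division (terms_of_deg n D) M)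
  (u : ('C(D + n - 1, n - 1)).-tuple 'X_{1..n})
  (u_uniq : uniq u)
  (u_enum : u =i terms_of_deg n D)
  (u_chain : forall i j : 'I_('C(D + n - 1, n - 1)),
     i <= j -> M (tnth u i) \subset M (tnth u j))
  (u_last : M (last 0%MM u) = [set: 'I_n]) :
  exists s : {perm 'I_n},
    let M' := relabel_div s M in
    let ul := relabel_term s (last 0%MM u) in
    [/\ forall i j : 'I_n, i <= j ->
          M' (U_(i) *+ D)%MM \subset M' (U_(j) *+ D)%MM,
        (forall v, v \in terms_of_deg n D -> M' v = [set: 'I_n] <-> v = ul) /\
        (exists i : 'I_n, ul = (U_(i) *+ D)%MM),
        forall i : 'I_n, M' (U_(i) *+ D)%MM = [set j : 'I_n | j <= i]
      & forall v, v \in terms_of_deg n D -> M' v = pommaret v].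
Proof.
have cmp v w : v \in terms_of_deg n D -> w \in terms_of_deg n D ->
    M v \subset M w \/ M w \subset M v.
  rewrite -!u_enum => /tnthP[i ->] /tnthP[j ->].
  by case: (leqP i j) => [|/ltnW] /u_chain; [left | right].
have lastU : last 0%MM u \in terms_of_deg n D.
  (* The enumeration is not empty, since it contains x_1^D. *)
  have := mem_pure_power D (Ordinal hn).
  rewrite -!u_enum !memtE; case: (tval u) => [|a l] //= _; exact: mem_last.
have [s sE] := pure_powers_perm hD hM cmp; exists s.
set M' := relabel_div s M; set ul := relabel_term s _.
have hM' : relative_involutive_division (terms_of_deg n D) M'.
  exact: relabel_division.
have cmp' v w : v \in terms_of_deg n D -> w \in terms_of_deg n D ->
    M' v \subset M' w \/ M' w \subset M' v.
  move=> vU wU.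
  have := cmp (relabel_term s^-1 v) (relabel_term s^-1 w).
  rewrite !mem_relabel_term => /(_ vU wU).
  by case=> sub; [left | right]; apply: relabel_div_mono.
have pureM (i : 'I_n) : M' (U_(i) *+ D)%MM = [set j : 'I_n | j <= i].
  by apply/setP => j; rewrite !inE relabel_pure_power sE.
have ulU : ul \in terms_of_deg n D by rewrite mem_relabel_term.
have ul_full : M' ul = [set: 'I_n].
  by apply/setP => i; rewrite !inE relabel_termK u_last inE.
have full_uniq v : v \in terms_of_deg n D -> M' v = [set: 'I_n] -> v = ul.
  move=> vU vfull; apply: (cones_meet_eq hM' vU ulU (in_cone_full ul vfull)).
  by rewrite addmC; apply: in_cone_full.
split=> //.
- by move=> i j ij; rewrite !pureM; apply/subsetP => k; rewrite !inE => /leq_trans ->.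
- split=> [v vU|]; first by split=> [|->]; first exact: full_uniq.
  have last_lt : n.-1 < n by rewrite prednK.
  exists (Ordinal last_lt); apply/esym/full_uniq; first exact: mem_pure_power.
  by rewrite pureM; apply/setP => j; rewrite !inE /= -ltnS prednK ?ltn_ord.
- move=> v vU; have [k vk] := exists_var hD vU.
  have [j minv] := exists_min_var vk.
  rewrite (pommaret_min_var minv).
  exact: (multiplicative_eq_below_min hM' cmp' pureM).
Qed.
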